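(* Let $D$ be an integrally closed domain. The following conditions are equivalent: (i) $D$ is a quasi-stable domain; (ii) $D$ is a finitely stable domain; (iii) $D$ is a Prüfer domain.
   Context: $D$ is an integral domain with quotient field $K$. ''Ideal of $D$'' means fractional ideal: a $D$-submodule $I$ of $K$ with $dI\subseteq D$ for some nonzero $d\in D$. For a nonzero ideal $I$, $(I:I)=\{x\in K\mid xI\subseteq I\}$ is a ring between $D$ and $K$, and $I$ is an ideal of it. A nonzero ideal $I$ is stable if $I$ is a projective $(I:I)$-module, and quasi-stable if $I$ is a flat $(I:I)$-module. $D$ is finitely stable if each nonzero finitely generated ideal of $D$ is stable; $D$ is quasi-stable if each nonzero ideal of $D$ is quasi-stable. A Prüfer domain is a domain in which every nonzero finitely generated ideal is invertible. *)

(* Defs.v *)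
From HB Require Import structures.
From mathcomp Require Export all_boot all_algebra.
From mathcomp Require Export boolp classical_sets.

Set Implicit Arguments.
Unset Strict Implicit.
Unset Printing Implicit Defensive.

Import GRing.Theory.
Local Open Scope ring_scope.
Local Open Scope classical_set_scope.

Notation tofrac := (@FracField.tofrac _).
Notation "x %:F" := (tofrac x) : ring_scope.

Definition projective_module (R : comNzRingType) (M : lmodType R) : Prop :=
  forall (A B : lmodType R) (g : {linear A -> B}) (f : {linear M -> B}),
    (forall b, exists a, g a = b) ->
    exists h : {linear M -> A}, forall m, g (h m) = f m.

(* The list [:: (n_1, m_1); ...; (n_k, m_k)] stands for the element
   n_1 (x) m_1 + ... + n_k (x) m_k of the tensor product of N and M over R, and
   tensor_eq is equality in that tensor product, i.e. the congruence on the
   free commutative monoid on N * M generated by the bilinearity relations.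
   Lists without signs suffice, as (- n) (x) m is the opposite of n (x) m. *)
Inductive tensor_eq (R : comNzRingType) (N M : lmodType R) :
    seq (N * M) -> seq (N * M) -> Prop :=
  | TensorRefl s : tensor_eq s s
  | TensorSym s t : tensor_eq s t -> tensor_eq t s
  | TensorTrans s t u : tensor_eq s t -> tensor_eq t u -> tensor_eq s u
  | TensorCat s s' t t' :
      tensor_eq s s' -> tensor_eq t t' -> tensor_eq (s ++ t) (s' ++ t')
  | TensorComm s t : tensor_eq (s ++ t) (t ++ s)
  | TensorZero m : tensor_eq [:: (0, m)] [::]
  | TensorAddl n n' m : tensor_eq [:: (n + n', m)] [:: (n, m); (n', m)]
  | TensorAddr n m m' : tensor_eq [:: (n, m + m')] [:: (n, m); (n, m')]
  | TensorScale a n m : tensor_eq [:: (a *: n, m)] [:: (n, a *: m)].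

Definition tensor_map (R : comNzRingType) (N N' M : lmodType R)
    (f : N -> N') (s : seq (N * M)) : seq (N' * M) :=
  [seq (f p.1, p.2) | p <- s].

(* Tensoring with M preserves injectivity of linear maps. *)
Definition flat_module (R : comNzRingType) (M : lmodType R) : Prop :=
  forall (N N' : lmodType R) (f : {linear N -> N'}), injective f ->
    forall s t : seq (N * M),
      tensor_eq (tensor_map f s) (tensor_map f t) -> tensor_eq s t.

Record frac_ideal (D : idomainType) := FracIdeal {
  ideal_set :> {fraction D} -> Prop;
  ideal0 : ideal_set 0;
  idealD : forall x y, ideal_set x -> ideal_set y -> ideal_set (x + y);
  idealM : forall (d : D) x, ideal_set x -> ideal_set (d%:F * x);
  ideal_denom : exists2 d : D, d != 0 &
    forall x, ideal_set x -> exists e : D, d%:F * x = e%:F }.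

Definition nonzero_ideal (D : idomainType) (I : frac_ideal D) : Prop :=
  exists2 x, I x & x != 0.

Definition fg_ideal (D : idomainType) (I : frac_ideal D) : Prop :=
  exists (n : nat) (g : 'I_n -> {fraction D}), forall x,
    I x <-> exists c : 'I_n -> D, x = \sum_(i < n) (c i)%:F * g i.

Definition ideal_mul (D : idomainType) (I J : frac_ideal D) :
    set {fraction D} :=
  [set x | exists (n : nat) (a b : 'I_n -> {fraction D}),
    [/\ forall i, I (a i), forall i, J (b i) & x = \sum_(i < n) a i * b i]].

Definition invertible_ideal (D : idomainType) (I : frac_ideal D) : Prop :=
  exists J : frac_ideal D, ideal_mul I J = range (@FracField.tofrac D).

Section Endomorphisms.
Variables (D : idomainType) (I : frac_ideal D).

Definition colon_set : set {fraction D} :=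
  [set x | forall y, I y -> I (x * y)].

Definition colon_pred : {pred {fraction D}} := fun x => x \in colon_set.
Definition ideal_pred : {pred {fraction D}} := fun x => x \in [set y | I y].

Lemma colon_predE x : reflect (colon_set x) (x \in colon_pred).
Proof. by apply: (iffP idP) => [/set_mem//|h]; apply: mem_set. Qed.

Lemma ideal_predE x : reflect (I x) (x \in ideal_pred).
Proof. by apply: (iffP idP) => [/set_mem//|h]; apply: mem_set. Qed.

Lemma idealN x : I x -> I (- x).
Proof. by move/(idealM (-1)); rewrite tofracN tofrac1 mulN1r. Qed.

Fact ideal_zmod_closed : zmod_closed ideal_pred.
Proof.
split=> [|x y /ideal_predE Ix /ideal_predE Iy]; apply/ideal_predE.
  exact: ideal0.
by apply: idealD => //; apply: idealN.
Qed.

Fact colon_subring_closed : subring_closed colon_pred.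
Proof.
split=> [|x y /colon_predE hx /colon_predE hy|x y /colon_predE hx /colon_predE hy];
  apply/colon_predE => z Iz.
- by rewrite mul1r.
- by rewrite mulrBl; apply: idealD; [apply: hx | apply/idealN/hy].
- by rewrite -mulrA; apply/hx/hy.
Qed.

HB.instance Definition _ :=
  GRing.isZmodClosed.Build {fraction D} ideal_pred ideal_zmod_closed.
HB.instance Definition _ :=
  GRing.isSubringClosed.Build {fraction D} colon_pred colon_subring_closed.

Record colon_ring := ColonRing {
  colon_val : {fraction D};
  colon_valP : colon_val \in colon_pred }.

HB.instance Definition _ := [isSub for colon_val].
HB.instance Definition _ := [Choice of colon_ring by <:].
HB.instance Definition _ := [SubChoice_isSubComNzRing of colon_ring by <:].

Record ideal_module := IdealModule {
  ideal_val : {fraction D};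
  ideal_valP : ideal_val \in ideal_pred }.

HB.instance Definition _ := [isSub for ideal_val].
HB.instance Definition _ := [Choice of ideal_module by <:].
HB.instance Definition _ := [SubChoice_isSubZmodule of ideal_module by <:].

Fact ideal_scale_subproof (a : colon_ring) (x : ideal_module) :
  colon_val a * ideal_val x \in ideal_pred.
Proof.
apply/ideal_predE; apply: (elimT (colon_predE _) (colon_valP a)).
exact: (elimT (ideal_predE _) (ideal_valP x)).
Qed.

Definition ideal_scale (a : colon_ring) (x : ideal_module) : ideal_module :=
  IdealModule (ideal_scale_subproof a x).

Fact ideal_scaleA a b x :
  ideal_scale a (ideal_scale b x) = ideal_scale (a * b) x.
Proof. by apply: val_inj => /=; rewrite mulrA. Qed.

Fact ideal_scale1 : left_id 1 ideal_scale.
Proof. by move=> x; apply: val_inj => /=; rewrite mul1r. Qed.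

Fact ideal_scaleDr : right_distributive ideal_scale +%R.
Proof. by move=> a x y; apply: val_inj => /=; rewrite mulrDr. Qed.

Fact ideal_scaleDl x : {morph ideal_scale^~ x : a b / a + b}.
Proof. by move=> a b; apply: val_inj => /=; rewrite mulrDl. Qed.

HB.instance Definition _ := GRing.Zmodule_isLmodule.Build
  colon_ring ideal_module ideal_scaleA ideal_scale1 ideal_scaleDr ideal_scaleDl.

Definition stable_ideal : Prop :=
  nonzero_ideal I /\ @projective_module colon_ring ideal_module.

Definition quasi_stable_ideal : Prop :=
  nonzero_ideal I /\ @flat_module colon_ring ideal_module.

End Endomorphisms.

Definition integrally_closed (D : idomainType) : Prop :=
  forall x : {fraction D},
    integralOver (@FracField.tofrac D) x -> exists d : D, x = d%:F.

Definition quasi_stable_domain (D : idomainType) : Prop :=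
  forall I : frac_ideal D, nonzero_ideal I -> quasi_stable_ideal I.

Definition finitely_stable_domain (D : idomainType) : Prop :=
  forall I : frac_ideal D, nonzero_ideal I -> fg_ideal I -> stable_ideal I.

Definition prufer_domain (D : idomainType) : Prop :=
  forall I : frac_ideal D, nonzero_ideal I -> fg_ideal I -> invertible_ideal I.

(* Main.v *)
From HB Require Import structures.
From mathcomp Require Import zify.
Require Import Defs.

(** Each of the three properties is compared with the existence of dual bases:
    elements a_k of the ideal [I] and b_k of the quotient field such that
    \sum_k a_k b_k = 1 and every b_k sends [I] into [D]. For a nonzero ideal
    this means invertibility ([invertible_dual_basis],
    [dual_basis_invertible]).

    If [D] is integrally closed and [I] is finitely generated and nonzero, then
    (I : I) = D by the determinant trick ([colon_integral]). Hence it is enough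
    to find b_k that send [I] into (I : I). When [I] is projective over (I : I)
    they come from a splitting of a surjection from a free module
    ([projective_dual_basis]). When [I] is flat they come from the equational
    criterion for flatness ([flat_equational]), applied to the relations
    a_i a_j = a_j a_i between the generators of [I] ([flat_dual_basis]). The
    criterion itself is deduced from the exactness of tensoring with a flat
    module ([flat_exact]).

    Conversely let [D] be a Pruefer domain. A finitely generated nonzero ideal
    has a dual basis, which shows that it is projective over (I : I)
    ([prufer_finitely_stable]). An arbitrary nonzero ideal [I] has a dual basis
    only on each of its finite subsets. This suffices for flatness, because an
    equality between tensors has a derivation in which finitely many elements
    of [I] occur ([tensor_eq_coord], [prufer_quasi_stable]). *)

Set Implicit Arguments.
Unset Strict Implicit.
Unset Printing Implicit Defensive.

Import GRing.Theory.
Local Open Scope ring_scope.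

(** * Calculus in tensor products *)

Section TensorLists.
Variables (R : comNzRingType) (N M : lmodType R).
Implicit Types (s t : seq (N * M)).

Lemma perm_tensor_eq s t : perm_eq s t -> tensor_eq s t.
Proof.
elim: s t => [|p s IHs] t.
  by rewrite perm_sym => /perm_nilP ->; exact: TensorRefl.
move=> st; have pt : p \in t by rewrite -(perm_mem st) mem_head.
case/splitPr: pt st => t1 t2.
rewrite perm_sym perm_catC /= perm_cons perm_sym => /IHs st.
apply: (TensorTrans (TensorCat (TensorRefl [:: p]) st)) => /=.
exact: (TensorComm (p :: t2) t1).
Qed.

Lemma tensor_eq0r (n : N) : tensor_eq [:: (n, 0 : M)] [::].
Proof.
apply: TensorTrans (TensorZero N (0 : M)).
by apply: TensorSym; rewrite -{1}(scale0r n) -{2}(scale0r (0 : M)); apply: TensorScale.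
Qed.

Lemma tensor_eq_opp s :
  tensor_eq (s ++ [seq (- p.1, p.2) | p <- s]) [::].
Proof.
elim: s => [|[n m] s IHs] /=; first exact: TensorRefl.
apply: (@TensorTrans _ _ _ _ ([:: (n, m); (- n, m)] ++
   (s ++ [seq (- p.1, p.2) | p <- s]))).
  apply: perm_tensor_eq; apply/permP => q; rewrite /= !count_cat /=; lia.
rewrite -[X in tensor_eq _ X]cats0; apply: TensorCat IHs.
apply: TensorTrans (TensorZero N m).
by rewrite -(subrr n); apply/TensorSym/TensorAddl.
Qed.

Lemma tensor_eq_addl (K : eqType) (r : seq K) (f g : K -> N) (a : K -> M) :
  tensor_eq [seq (f k + g k, a k) | k <- r]
            ([seq (f k, a k) | k <- r] ++ [seq (g k, a k) | k <- r]).
Proof.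
elim: r => [|k r IHr] /=; first exact: TensorRefl.
apply: (TensorTrans (TensorCat (TensorAddl (f k) (g k) (a k)) IHr)).
apply: perm_tensor_eq; apply/permP => q; rewrite /= !count_cat /=; lia.
Qed.

Lemma tensor_eq_addr (K : eqType) (r : seq K) (f g : K -> M) (e : K -> N) :
  tensor_eq [seq (e k, f k + g k) | k <- r]
            ([seq (e k, f k) | k <- r] ++ [seq (e k, g k) | k <- r]).
Proof.
elim: r => [|k r IHr] /=; first exact: TensorRefl.
apply: (TensorTrans (TensorCat (TensorAddr (e k) (f k) (g k)) IHr)).
apply: perm_tensor_eq; apply/permP => q; rewrite /= !count_cat /=; lia.
Qed.

Lemma tensor_eq_suml (K : eqType) (r : seq K) (f : K -> N) (m : M) :
  tensor_eq [:: (\sum_(k <- r) f k, m)] [seq (f k, m) | k <- r].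
Proof.
elim: r => [|k r IHr] /=; first by rewrite big_nil; apply: TensorZero.
rewrite big_cons; apply: TensorTrans (TensorAddl _ _ _) _.
exact: (TensorCat (TensorRefl [:: (f k, m)]) IHr).
Qed.

Lemma tensor_eq_sumr (K : eqType) (r : seq K) (n : N) (f : K -> M) :
  tensor_eq [:: (n, \sum_(k <- r) f k)] [seq (n, f k) | k <- r].
Proof.
elim: r => [|k r IHr] /=; first by rewrite big_nil; apply: tensor_eq0r.
rewrite big_cons; apply: TensorTrans (TensorAddr _ _ _) _.
exact: (TensorCat (TensorRefl [:: (n, f k)]) IHr).
Qed.

Lemma tensor_eq_map (K : eqType) (r : seq K) (f g : K -> N * M) :
  (forall k, k \in r -> tensor_eq [:: f k] [:: g k]) ->
  tensor_eq [seq f k | k <- r] [seq g k | k <- r].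
Proof.
elim: r => [|k r IHr] fg /=; first exact: TensorRefl.
apply: (TensorCat (fg k (mem_head _ _)) (IHr _)) => l lr.
by apply: fg; rewrite inE lr orbT.
Qed.

Lemma tensor_eq_nil (K : eqType) (r : seq K) (f : K -> N * M) :
  (forall k, tensor_eq [:: f k] [::]) -> tensor_eq [seq f k | k <- r] [::].
Proof.
move=> f0; elim: r => [|k r IHr] /=; first exact: TensorRefl.
exact: (TensorCat (f0 k) IHr).
Qed.

(** Half of the universal property of the tensor product: this is how a formal
    identity of tensors is turned into an identity between elements. *)
Lemma tensor_eq_bilinear (G : nmodType) (b : N -> M -> G) s t :
  (forall m, b 0 m = 0) ->
  (forall n n' m, b (n + n') m = b n m + b n' m) ->
  (forall n m m', b n (m + m') = b n m + b n m') ->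
  (forall a n m, b (a *: n) m = b n (a *: m)) ->
  tensor_eq s t -> \sum_(p <- s) b p.1 p.2 = \sum_(p <- t) b p.1 p.2.
Proof.
move=> b0 bDl bDr bZ; elim=> {s t} //.
- by move=> s t u _ -> _ ->.
- by move=> s s' t t' _ IHs _ IHt; rewrite !big_cat /= IHs IHt.
- by move=> s t; rewrite !big_cat /= addrC.
- by move=> m; rewrite big_seq1 big_nil /= b0.
- by move=> n n' m; rewrite !big_cons !big_nil /= !addr0 bDl.
- by move=> n m m'; rewrite !big_cons !big_nil /= !addr0 bDr.
- by move=> a n m; rewrite !big_seq1 /= bZ.
Qed.

End TensorLists.

(** * Flat modules: exactness and the equational criterion *)

Section ImageModule.
Variables (R : comNzRingType) (P Q : lmodType R) (f : {linear P -> Q}).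

Definition image_pred : {pred Q} := fun y => `[< exists x, f x = y >].

Lemma image_predP y : reflect (exists x, f x = y) (y \in image_pred).
Proof. exact: asboolP. Qed.

Fact image_submod_closed : submod_closed image_pred.
Proof.
split=> [|a _ _ /image_predP[x <-] /image_predP[y <-]]; apply/image_predP.
  by exists 0; rewrite linear0.
by exists (a *: x + y); rewrite linearP.
Qed.

HB.instance Definition _ :=
  GRing.isSubmodClosed.Build R Q image_pred image_submod_closed.

Record image_module := ImageModule {
  image_val : Q;
  image_valP : image_val \in image_pred }.

HB.instance Definition _ := [isSub for image_val].
HB.instance Definition _ := [Choice of image_module by <:].
HB.instance Definition _ := [SubChoice_isSubLmodule of image_module by <:].

Definition image_corestr (x : P) : image_module :=
  ImageModule (introT (image_predP (f x)) (ex_intro _ x erefl)).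

Lemma image_surj (y : image_module) : exists x, f x = val y.
Proof. exact/image_predP/image_valP. Qed.

(** A set-theoretic section of the corestriction; it is linear only up to the
    kernel of [f], which is what [tensor_lift] has to keep track of. *)
Definition image_section (y : image_module) : P := projT1 (cid (image_surj y)).

Lemma image_sectionK y : f (image_section y) = val y.
Proof. exact: projT2 (cid (image_surj y)). Qed.

Section Lift.
Variable M : lmodType R.

Definition in_ker (k : seq (P * M)) := forall p, p \in k -> f p.1 = 0.

Lemma in_ker_cat k l : in_ker k -> in_ker l -> in_ker (k ++ l).
Proof. by move=> kk kl p; rewrite mem_cat => /orP[/kk|/kl]. Qed.

Lemma in_ker1 (x : P) (m : M) : f x = 0 -> in_ker [:: (x, m)].
Proof. by move=> fx p; rewrite inE => /eqP ->. Qed.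

(** Right exactness of the tensor product: each bilinearity relation between
    elements of the image lifts to the source up to a defect in the kernel of
    [f], because a section is additive and homogeneous modulo that kernel. *)
Lemma tensor_lift (s t : seq (image_module * M)) : tensor_eq s t ->
  exists2 k, in_ker k &
    tensor_eq (tensor_map image_section s) (tensor_map image_section t ++ k).
Proof.
have K0 : in_ker [::] by [].
elim=> {s t}.
- by move=> s; exists [::] => //; rewrite cats0; apply: TensorRefl.
- move=> s t _ [k kk st].
  exists [seq (- p.1, p.2) | p <- k].
    by move=> _ /mapP[p /kk pk ->]; rewrite /= linearN pk oppr0.
  apply: TensorSym.
  apply: (TensorTrans (TensorCat st (TensorRefl _))); rewrite -catA.
  rewrite -[X in tensor_eq _ X]cats0.
  exact: TensorCat (TensorRefl _) (tensor_eq_opp k).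
- move=> s t u _ [k kk st] _ [l kl tu].
  exists (l ++ k); first exact: in_ker_cat.
  by rewrite catA; apply: TensorTrans st (TensorCat tu (TensorRefl _)).
- move=> s s' t t' _ [k kk ss] _ [l kl tt].
  exists (k ++ l); first exact: in_ker_cat.
  rewrite /tensor_map in ss tt *; rewrite !map_cat.
  apply: (TensorTrans (TensorCat ss tt)).
  by apply: perm_tensor_eq; apply/permP => q; rewrite !count_cat; lia.
- move=> s t; exists [::] => //; rewrite cats0 /tensor_map !map_cat.
  exact: TensorComm.
- move=> m; exists [:: (image_section 0, m)]; last exact: TensorRefl.
  by apply: in_ker1; rewrite image_sectionK.
- move=> n n' m; set d := image_section (n + n') - (image_section n + image_section n').
  exists [:: (d, m)].
    by apply: in_ker1; rewrite linearB linearD !image_sectionK /= subrr.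
  rewrite /= -(subrKC (image_section n + image_section n') (image_section (n + n'))).
  apply: TensorTrans (TensorAddl _ _ _) _.
  exact: (TensorCat (TensorAddl _ _ _) (TensorRefl [:: (d, m)])).
- by move=> n m m'; exists [::] => //; apply: TensorAddr.
- move=> a n m; set d := image_section (a *: n) - a *: image_section n.
  exists [:: (d, m)].
    by apply: in_ker1; rewrite linearB linearZ !image_sectionK /= subrr.
  rewrite /= -(subrKC (a *: image_section n) (image_section (a *: n))).
  apply: TensorTrans (TensorAddl _ _ _) _.
  exact: (TensorCat (TensorScale _ _ _) (TensorRefl [:: (d, m)])).
Qed.

(** Exactness of ker f (x) M -> P (x) M -> Q (x) M. Flatness is applied to the
    inclusion of the image of [f] in [Q], so that the tensor already vanishes
    over the image; [tensor_lift] then pulls it back to the kernel. *)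
Lemma flat_exact (s : seq (P * M)) : flat_module M ->
  tensor_eq (tensor_map f s) [::] -> exists2 k, in_ker k & tensor_eq s k.
Proof.
move=> flatM fs0.
have /tensor_lift[k kk st] : tensor_eq (tensor_map image_corestr s) [::].
  apply: (flatM _ _ (val : {linear image_module -> Q}) val_inj).
  by rewrite /tensor_map -map_comp.
set g := fun x : P => x - image_section (image_corestr x).
exists ([seq (g p.1, p.2) | p <- s] ++ k).
  apply: in_ker_cat => // _ /mapP[p _ ->].
  by rewrite /g /= linearB image_sectionK subrr.
apply: TensorTrans (TensorCat (TensorRefl _) st).
rewrite /tensor_map -map_comp.
apply: TensorTrans (tensor_eq_addl s (fun p => g p.1) _ (fun p => p.2)).
under eq_map => p do rewrite subrK.
by rewrite map_id_in; [apply: TensorRefl | case].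
Qed.

End Lift.
End ImageModule.

(** A tensor over a free module is determined by its coordinates. *)
Lemma tensor_row_expand (R : comNzRingType) (M : lmodType R) p
    (s : seq ('rV[R]_p * M)) :
  tensor_eq s [seq (delta_mx 0 j : 'rV[R]_p,
                    \sum_(q <- s) q.1 0 j *: q.2) | j <- enum 'I_p].
Proof.
elim: s => [|[w x] s IHs].
  apply: TensorSym; apply: tensor_eq_nil => j; rewrite big_nil.
  exact: tensor_eq0r.
under eq_map => j do rewrite big_cons /=.
apply: TensorTrans (TensorSym (tensor_eq_addr _ _ _ _)).
apply: (TensorCat _ IHs : tensor_eq ([:: (w, x)] ++ s) _).
rewrite {1}(row_sum_delta w) -big_enum /=.
apply: TensorTrans (tensor_eq_suml _ _ _) _.
by apply: tensor_eq_map => j _; apply: TensorScale.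
Qed.

(** The equational criterion: in a flat module every system of linear relations
    is a consequence of relations between the coefficients. It is exactness at
    R^n (x) M for the map R^n -> R^p of matrix [A], since the relations say
    that the tensor of the e_i (x) m_i goes to zero. *)
Lemma flat_equational (R : comNzRingType) (M : lmodType R) n p
    (A : 'M[R]_(n, p)) (m : 'I_n -> M) :
  flat_module M -> (forall j, \sum_i A i j *: m i = 0) ->
  exists l (C : 'M[R]_(l, n)) (y : 'I_l -> M),
    C *m A = 0 /\ forall i, m i = \sum_k C k i *: y k.
Proof.
move=> flatM Am.
pose u := [seq (delta_mx 0 i : 'rV[R]_n, m i) | i <- enum 'I_n].
have /(flat_exact flatM)[k kk uk] : tensor_eq (tensor_map (mulmxr A) u) [::].
  apply: TensorTrans (tensor_row_expand _) _.
  apply: tensor_eq_nil => j.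
  rewrite /tensor_map -map_comp big_map big_enum /=.
  under eq_bigr => i _ do rewrite -rowE mxE.
  by rewrite Am; apply: tensor_eq0r.
pose x0 : 'rV[R]_n * M := (0, 0).
exists (size k), (\matrix_(a < size k) (nth x0 k a).1), (fun a => (nth x0 k a).2).
split.
  apply/row_matrixP => a; rewrite row_mul rowK row0.
  exact/kk/mem_nth.
move=> i.
have : \sum_(q <- u) q.1 0 i *: q.2 = \sum_(q <- k) q.1 0 i *: q.2.
  apply: (@tensor_eq_bilinear R 'rV[R]_n M M (fun r x => r 0 i *: x)
    u k _ _ _ _ uk) => [x|r r' x|r x x'|a r x].
  - by rewrite mxE scale0r.
  - by rewrite mxE scalerDl.
  - by rewrite scalerDr.
  - by rewrite mxE scalerA mulrC.
rewrite big_map big_enum /= (bigD1 i) //= big1 ?addr0; last first.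
  by move=> j ji; rewrite !mxE eq_sym (negPf ji) andbF scale0r.
rewrite mxE !eqxx scale1r (big_nth x0) big_mkord => ->.
by apply: eq_bigr => a _; rewrite !mxE.
Qed.

(** * Dual bases and invertible ideals *)

Section FractionalIdeals.
Variable D : idomainType.
Local Notation F := {fraction D}.
Implicit Types (I J : frac_ideal D).

Lemma ideal_sum I (K : eqType) (r : seq K) (g : K -> F) :
  (forall k, k \in r -> I (g k)) -> I (\sum_(k <- r) g k).
Proof.
move=> Ig; rewrite big_seq; apply: (big_ind I) => //.
  exact: ideal0.
exact: idealD.
Qed.

(** An invertible ideal is one that has elements a_k and multipliers b_k such
    that x = \sum_k (b_k x) a_k with coordinates b_k x in [D]. *)
Definition dual_basis I n (a b : 'I_n -> F) :=
  [/\ forall k, I (a k),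
      forall k x, I x -> exists e : D, b k * x = e%:F &
      \sum_k a k * b k = 1].

Lemma range_tofrac_sum n (g : 'I_n -> F) :
  (forall i, exists e : D, g i = e%:F) -> exists e : D, \sum_i g i = e%:F.
Proof.
move=> gD; apply: (big_ind (fun x => exists e : D, x = e%:F)) => //.
  by exists 0; rewrite tofrac0.
by move=> _ _ [e ->] [f ->]; exists (e + f); rewrite tofracD.
Qed.

Lemma invertible_dual_basis I :
  invertible_ideal I -> exists n (a b : 'I_n -> F), dual_basis I a b.
Proof.
move=> [J IJ].
have : ideal_mul I J 1 by rewrite IJ; exists 1 => //; rewrite tofrac1.
move=> [n [a [b [Ia Jb e1]]]]; exists n, a, b; split=> // k x Ix.
have : ideal_mul I J (x * b k).
  by exists 1, (fun=> x), (fun=> b k); split=> //; rewrite big_ord1.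
by rewrite IJ mulrC => -[e _ <-]; exists e.
Qed.

Section InverseIdeal.
Variable I : frac_ideal D.
Hypothesis I0 : nonzero_ideal I.

(** The ideal (D : I), the only candidate for an inverse of [I]. *)
Definition inverse_set (y : F) := forall x, I x -> exists e : D, y * x = e%:F.

Fact inverse0 : inverse_set 0.
Proof. by move=> x _; exists 0; rewrite mul0r tofrac0. Qed.

Fact inverseD x y : inverse_set x -> inverse_set y -> inverse_set (x + y).
Proof.
move=> Jx Jy z Iz; have [e ez] := Jx z Iz; have [f fz] := Jy z Iz.
by exists (e + f); rewrite mulrDl ez fz tofracD.
Qed.

Fact inverseM (d : D) x : inverse_set x -> inverse_set (d%:F * x).
Proof.
by move=> Jx z /Jx[e ez]; exists (d * e); rewrite -mulrA ez tofracM.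
Qed.

Fact inverse_denom : exists2 d : D, d != 0 &
  forall x, inverse_set x -> exists e : D, d%:F * x = e%:F.
Proof.
have [x Ix x0] := I0; have [d d0 dI] := ideal_denom I; have [e dx] := dI x Ix.
exists e => [|y Jy].
  by rewrite -tofrac_eq0 -dx mulf_neq0 ?tofrac_eq0.
have [f yx] := Jy x Ix; exists (d * f).
by rewrite -dx -mulrA [x * y]mulrC yx tofracM.
Qed.

Definition inverse_ideal := FracIdeal inverse0 inverseD inverseM inverse_denom.

Lemma dual_basis_invertible n (a b : 'I_n -> F) :
  dual_basis I a b -> invertible_ideal I.
Proof.
move=> [Ia Jb e1]; exists inverse_ideal; apply/seteqP; split=> x /=.
  move=> [m [g [h [Ig Jh ->]]]].
  have [i|e ->] := @range_tofrac_sum _ (fun i => g i * h i); last by exists e.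
  by rewrite mulrC; apply: Jh.
move=> [e _ <-]; exists n, a, (fun k => e%:F * b k); split=> //.
  by move=> k; apply: inverseM; apply: Jb.
under eq_bigr => k _ do rewrite mulrCA.
by rewrite -mulr_sumr e1 mulr1.
Qed.

End InverseIdeal.

Section SpanIdeal.
Variables (I : frac_ideal D) (n : nat) (g : 'I_n -> F).
Hypothesis Ig : forall i, I (g i).

Definition span_set (x : F) :=
  exists c : 'I_n -> D, x = \sum_i (c i)%:F * g i.

Fact span0 : span_set 0.
Proof. by exists (fun=> 0); rewrite big1 // => i _; rewrite tofrac0 mul0r. Qed.

Fact spanD x y : span_set x -> span_set y -> span_set (x + y).
Proof.
move=> [c ->] [e ->]; exists (fun i => c i + e i); rewrite -big_split /=.
by apply: eq_bigr => i _; rewrite tofracD mulrDl.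
Qed.

Fact spanM (d : D) x : span_set x -> span_set (d%:F * x).
Proof.
move=> [c ->]; exists (fun i => d * c i); rewrite mulr_sumr.
by apply: eq_bigr => i _; rewrite tofracM mulrA.
Qed.

Lemma span_sub x : span_set x -> I x.
Proof. by move=> [c ->]; apply: ideal_sum => i _; apply: idealM. Qed.

Fact span_denom : exists2 d : D, d != 0 &
  forall x, span_set x -> exists e : D, d%:F * x = e%:F.
Proof.
by have [d d0 dI] := ideal_denom I; exists d => // x /span_sub/dI.
Qed.

Definition span_ideal := FracIdeal span0 spanD spanM span_denom.

Lemma fg_span : fg_ideal span_ideal.
Proof. by exists n, g. Qed.

Lemma mem_span i : span_ideal (g i).
Proof.
exists (fun j => (j == i)%:R); rewrite (bigD1 i) //= eqxx tofrac1 mul1r.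
by rewrite big1 ?addr0 // => j /negPf ->; rewrite tofrac0 mul0r.
Qed.

End SpanIdeal.

(** In a Pruefer domain an arbitrary ideal has dual bases on each of its finite
    subsets [X]: the finitely generated ideal spanned by [X] has one. *)
Lemma prufer_dual_basis I (X : seq F) : prufer_domain D -> nonzero_ideal I ->
  (forall x, x \in X -> I x) ->
  exists n (a b : 'I_n -> F),
    [/\ forall k, I (a k),
        forall k x, x \in X -> exists e : D, b k * x = e%:F &
        \sum_k a k * b k = 1].
Proof.
(* All elements of [X] may vanish; [z] makes the span nonzero. *)
move=> prufD [z Iz z0] IX; pose Y := z :: X.
have IY (i : 'I_(size Y)) : I (nth 0 Y i).
  by have := mem_nth 0 (ltn_ord i); rewrite inE => /predU1P[->|/IX].
pose J := span_ideal IY.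
have JY x : x \in Y -> J x.
  move=> xY; rewrite -(nth_index 0 xY).
  have iY : (index x Y < size Y)%N by rewrite index_mem.
  exact: (mem_span IY (Ordinal iY)).
have J0 : nonzero_ideal J by exists z => //; apply/JY/mem_head.
have [n [a [b [Ja bJ e1]]]] := invertible_dual_basis (prufD J J0 (fg_span IY)).
exists n, a, b; split=> // [k|k x xX]; first exact: (span_sub IY (Ja k)).
by apply/bJ/JY; rewrite inE xX orbT.
Qed.

(** * Coordinates relative to a dual basis *)

Lemma range_sub_colon I (d : D) : colon_set I d%:F.
Proof. by move=> x; apply: idealM. Qed.

Definition to_colon I (d : D) : colon_ring I :=
  ColonRing (introT (colon_predE I _) (range_sub_colon (I := I) d)).

Definition to_ideal I (x : F) (Ix : I x) : ideal_module I :=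
  IdealModule (introT (ideal_predE I x) Ix).

(** Multiplication by [b], as a map from [I] to (I : I). The junk value 0 occurs
    where [b * x] lies outside (I : I), which makes [coord] total, but linear
    only on the elements that [b] sends into (I : I). *)
Definition coord I (b : F) (x : ideal_module I) : colon_ring I :=
  insubd (0 : colon_ring I) (b * ideal_val x).

Lemma coordE I b (x : ideal_module I) :
  colon_set I (b * ideal_val x) -> colon_val (coord b x) = b * ideal_val x.
Proof. by move=> bx; apply: insubdK; apply/colon_predE. Qed.

Lemma coordD I b (x y : ideal_module I) :
  colon_set I (b * ideal_val x) -> colon_set I (b * ideal_val y) ->
  coord b (x + y) = coord b x + coord b y.
Proof.
move=> bx by_; have bxy : colon_set I (b * ideal_val (x + y)).
  by rewrite /= mulrDr; apply/colon_predE/rpredD; apply/colon_predE.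
by apply: val_inj; rewrite /= coordE // !coordE // mulrDr.
Qed.

Lemma coordZ I b a (x : ideal_module I) :
  colon_set I (b * ideal_val x) -> coord b (a *: x) = a * coord b x.
Proof.
move=> bx; have bax : colon_set I (b * ideal_val (a *: x)).
  rewrite /= mulrCA.
  by apply/colon_predE/rpredM; [apply: colon_valP | apply/colon_predE].
by apply: val_inj; rewrite /= coordE // coordE // mulrCA.
Qed.

Lemma ideal_val_sum I (K : Type) (r : seq K) (g : K -> ideal_module I) :
  ideal_val (\sum_(k <- r) g k) = \sum_(k <- r) ideal_val (g k).
Proof. exact: (big_morph (@ideal_val _ I) (fun _ _ => erefl) erefl). Qed.

Lemma dual_basis_expand I n (a : 'I_n -> ideal_module I) (b : 'I_n -> F)
    (x : ideal_module I) :
  \sum_k ideal_val (a k) * b k = 1 ->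
  (forall k, colon_set I (b k * ideal_val x)) ->
  x = \sum_k coord (b k) x *: a k.
Proof.
move=> e1 bx; apply: val_inj; rewrite /= ideal_val_sum -[LHS]mul1r -e1 mulr_suml.
by apply: eq_bigr => k _ /=; rewrite coordE // -mulrA mulrC.
Qed.

(** The map n (x) x |-> (b x) n is well defined on tensors over an ideal whose
    elements [b] sends into (I : I), but [b] need not do so on the whole of [I].
    A given derivation of an equality of tensors only meets finitely many
    elements of [I], and it is enough that [b] behaves well on those. *)
Lemma tensor_eq_coord I (N : lmodType (colon_ring I))
    (s t : seq (N * ideal_module I)) :
  tensor_eq s t -> exists X : seq (ideal_module I), forall b,
    (forall x, x \in X -> colon_set I (b * ideal_val x)) ->
    \sum_(p <- s) coord b p.2 *: p.1 = \sum_(p <- t) coord b p.2 *: p.1.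
Proof.
elim=> {s t}.
- by exists [::].
- by move=> s t _ [X eqX]; exists X => b /eqX.
- move=> s t u _ [X eqX] _ [Y eqY]; exists (X ++ Y) => b bXY.
  rewrite eqX ?eqY // => x xX; apply: bXY; by rewrite mem_cat xX ?orbT.
- move=> s s' t t' _ [X eqX] _ [Y eqY]; exists (X ++ Y) => b bXY.
  rewrite !big_cat /= eqX ?eqY // => x xX; apply: bXY; by rewrite mem_cat xX ?orbT.
- by move=> s t; exists [::] => b _; rewrite !big_cat /= addrC.
- by move=> m; exists [::] => b _; rewrite big_seq1 big_nil scaler0.
- by move=> n n' m; exists [::] => b _; rewrite !big_cons !big_nil /= !addr0 scalerDr.
- move=> n m m'; exists [:: m; m'] => b bX.
  rewrite !big_cons !big_nil /= !addr0 coordD ?scalerDl //; apply: bX;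
    by rewrite !inE eqxx ?orbT.
- move=> a n m; exists [:: m] => b bX; rewrite !big_seq1 /= coordZ.
    by rewrite scalerA mulrC.
  by apply: bX; rewrite inE.
Qed.

(** From n (x) x = \sum_k n (x) (b_k x) a_k = \sum_k (b_k x) n (x) a_k. *)
Lemma tensor_coord_expand I (N : lmodType (colon_ring I)) n
    (a : 'I_n -> ideal_module I) (b : 'I_n -> F) (s : seq (N * ideal_module I)) :
  \sum_k ideal_val (a k) * b k = 1 ->
  (forall k p, p \in s -> colon_set I (b k * ideal_val p.2)) ->
  tensor_eq s [seq (\sum_(p <- s) coord (b k) p.2 *: p.1, a k) | k <- enum 'I_n].
Proof.
move=> e1; elim: s => [|[v x] s IHs] bs.
  apply: TensorSym; apply: tensor_eq_nil => k; rewrite big_nil.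
  exact: TensorZero.
under eq_map => k do rewrite big_cons /=.
apply: TensorTrans (TensorSym (tensor_eq_addl _ _ _ _)).
apply: (TensorCat _ (IHs _) : tensor_eq ([:: (v, x)] ++ s) _); last first.
  by move=> k p ps; apply: bs; rewrite inE ps orbT.
have {1}-> : x = \sum_k coord (b k) x *: a k.
  by apply: dual_basis_expand => // k; apply: (bs k (v, x)); apply: mem_head.
rewrite -big_enum /=.
apply: TensorTrans (tensor_eq_sumr _ _ _) _.
by apply: tensor_eq_map => k _; apply/TensorSym/TensorScale.
Qed.

(** * Pruefer domains are quasi-stable and finitely stable *)

(** If f (x) I identifies two tensors, a derivation of this uses finitely many
    elements of [I]; on these there is a dual basis, and the coordinates of the
    tensors relative to it are elements of [N], which the injective map [f]
    already separates. *)
Lemma prufer_quasi_stable : prufer_domain D -> quasi_stable_domain D.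
Proof.
move=> prufD I I0; split=> // N N' f injf s t /tensor_eq_coord[X eqX].
pose Y := X ++ [seq p.2 | p <- s ++ t].
have [n [a [b [Ia bY e1]]]] :
    exists n (a b : 'I_n -> F),
    [/\ forall k, I (a k),
        forall k x, x \in [seq ideal_val y | y <- Y] -> exists e : D, b k * x = e%:F &
        \sum_k a k * b k = 1].
  apply: prufer_dual_basis => // _ /mapP[y _ ->].
  exact/ideal_predE/ideal_valP.
pose a' k := to_ideal (Ia k).
have {}bY k y : y \in Y -> colon_set I (b k * ideal_val y).
  by move=> yY; have [|e ->] := bY k (ideal_val y); [exact: map_f | exact: range_sub_colon].
have eqst k : \sum_(p <- s) coord (b k) p.2 *: p.1
            = \sum_(p <- t) coord (b k) p.2 *: p.1.
  apply: injf; rewrite !linear_sum.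
  have := eqX (b k); rewrite !big_map => e.
  transitivity (\sum_(j <- s) coord (b k) j.2 *: f j.1).
    by apply: eq_bigr => p _; rewrite linearZ.
  rewrite e; first by apply: eq_bigr => p _; rewrite linearZ.
  by move=> x xX; apply: bY; rewrite mem_cat xX.
apply: (TensorTrans (@tensor_coord_expand _ _ _ a' b s e1 _)).
  by move=> k p ps; apply: bY; rewrite mem_cat map_f ?orbT // mem_cat ps.
under eq_map => k do rewrite eqst.
apply: TensorSym; apply: tensor_coord_expand => // k p pt.
by apply: bY; rewrite mem_cat map_f ?orbT // mem_cat pt orbT.
Qed.

(** A dual basis makes [I] a direct summand of a free module: to lift [f] along
    [g], lift the f(a_k) and extend by means of the coordinates. *)
Lemma prufer_finitely_stable : prufer_domain D -> finitely_stable_domain D.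
Proof.
move=> prufD I I0 fgI; split=> // A B g f surjg.
have [n [a [b [Ia bI e1]]]] := invertible_dual_basis (prufD I I0 fgI).
pose a' k := to_ideal (Ia k).
have bC k (x : ideal_module I) : colon_set I (b k * ideal_val x).
  have [|e ->] := bI k (ideal_val x); last exact: range_sub_colon.
  exact/ideal_predE/ideal_valP.
pose c k := projT1 (cid (surjg (f (a' k)))).
have gc k : g (c k) = f (a' k) by exact: projT2 (cid (surjg (f (a' k)))).
pose h x := \sum_k coord (b k) x *: c k.
have lin_h : linear h.
  move=> r x y; rewrite /h scaler_sumr -big_split /=; apply: eq_bigr => k _.
  by rewrite coordD // coordZ // scalerDl scalerA.
pose H := HB.pack_for {linear ideal_module I -> A} h
  (GRing.isLinear.Build _ _ _ _ h lin_h).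
exists H => x; rewrite {2}(@dual_basis_expand I n a' b x) //.
by rewrite !linear_sum; apply: eq_bigr => k _; rewrite !linearZ /= gc.
Qed.

End FractionalIdeals.

(** * Stability and quasi-stability imply invertibility *)

Section IntegrallyClosed.
Variable D : idomainType.
Local Notation F := {fraction D}.
Implicit Types (I J : frac_ideal D).

Lemma fg_ideal_generators I : nonzero_ideal I -> fg_ideal I ->
  exists n (a : 'I_n -> F),
    [/\ forall i, I (a i),
        forall x, I x -> exists c : 'I_n -> D, x = \sum_i (c i)%:F * a i &
        exists i, a i != 0].
Proof.
move=> [z Iz z0] [n [a Ia]]; exists n, a; split=> [i|x /Ia//|].
  apply/Ia; exists (fun j => (j == i)%:R); rewrite (bigD1 i) //=.
  rewrite eqxx tofrac1 mul1r big1 ?addr0 // => j /negPf ->.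
  by rewrite tofrac0 mul0r.
apply: contrapT => a0; move: z0; have /Ia[c ->] := Iz.
rewrite big1 ?eqxx // => i _; have [->|ai0] := eqVneq (a i) 0.
  by rewrite mulr0.
by case: a0; exists i.
Qed.

(** The determinant trick: multiplication by [x] on the generators of [I] is
    given by a matrix over [D], of which [x] is an eigenvalue, so that [x] is a
    root of its characteristic polynomial. *)
Lemma colon_integral I x : nonzero_ideal I -> fg_ideal I -> colon_set I x ->
  integralOver (@FracField.tofrac D) x.
Proof.
move=> I0 /(fg_ideal_generators I0)[n [a [Ia genI [i0 ai0]]]] xI.
have /choice[c xa] j : exists c : 'I_n -> D, x * a j = \sum_i (c i)%:F * a i.
  by apply/genI/xI.
pose A := \matrix_(i, j) c j i.
exists (char_poly A); first exact: char_poly_monic.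
rewrite map_char_poly -eigenvalue_root_char; apply/eigenvalueP.
exists (\row_i a i).
  apply/rowP => j; rewrite !mxE xa; apply: eq_bigr => i _.
  by rewrite !mxE mulrC.
by apply: contraNneq ai0 => /rowP/(_ i0); rewrite !mxE => ->.
Qed.

Lemma integrally_closed_colon I x : integrally_closed D ->
  nonzero_ideal I -> fg_ideal I -> colon_set I x -> exists d : D, x = d%:F.
Proof. by move=> Dic I0 fgI /(colon_integral I0 fgI)/Dic. Qed.

(** A section of (I : I)^n -> I has coordinates that are (I : I)-linear maps
    I -> (I : I), and such a map is multiplication by an element of the
    quotient field, namely by its value at any [z != 0] divided by [z]. *)
Lemma projective_dual_basis I n (a : 'I_n -> F) :
  nonzero_ideal I -> (forall i, I (a i)) ->
  (forall x, I x -> exists c : 'I_n -> D, x = \sum_i (c i)%:F * a i) ->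
  @projective_module (colon_ring I) (ideal_module I) ->
  exists q : 'I_n -> F,
    (forall k x, I x -> colon_set I (q k * x)) /\ \sum_k a k * q k = 1.
Proof.
move=> [z Iz z0] Ia genI projI.
pose a' k := to_ideal (Ia k).
pose g (r : 'rV[colon_ring I]_n) := \sum_k r 0 k *: a' k.
have lin_g : linear g.
  move=> t r s; rewrite /g scaler_sumr -big_split /=; apply: eq_bigr => k _.
  by rewrite !mxE scalerDl scalerA.
pose G := HB.pack_for {linear 'rV[colon_ring I]_n -> ideal_module I} g
  (GRing.isLinear.Build _ _ _ _ g lin_g).
have surjG x : exists r, G r = x.
  have [|c xE] := genI (ideal_val x); first exact/ideal_predE/ideal_valP.
  exists (\row_k to_colon I (c k)); apply: val_inj; rewrite /= /g ideal_val_sum xE.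
  by apply: eq_bigr => k _; rewrite !mxE.
have [h hK] := projI _ _ G (idfun : {linear ideal_module I -> ideal_module I}) surjG.
pose z' := to_ideal Iz.
pose H k x := colon_val (h x 0 k).
have HE k x : H k x = H k z' / z * ideal_val x.
  (* Evaluate the linear map h at (d z) x = (d x) z, where [d] clears the
     denominators of [I]. *)
  have [d d0 dI] := ideal_denom I.
  have [e ez] := dI z Iz.
  have [f fx] : exists f : D, d%:F * ideal_val x = f%:F.
    by apply/dI/ideal_predE/ideal_valP.
  have zx : to_colon I e *: x = to_colon I f *: z'.
    by apply: val_inj; rewrite /= -ez -fx mulrAC.
  have := congr1 (fun y => H k y) zx; rewrite /H !linearZ !mxE /= -ez -fx.
  rewrite -!mulrA => /mulfI; rewrite tofrac_eq0 => /(_ d0) e1.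
  by apply: (mulfI z0); rewrite e1 [RHS]mulrCA mulVKf // mulrC.
exists (fun k => H k z' / z); split=> [k x Ix|].
  have := HE k (to_ideal Ix) => /= <-.
  exact/colon_predE/colon_valP.
apply: (mulIf z0); rewrite mul1r mulr_suml -[RHS]/(ideal_val z').
rewrite -[X in ideal_val X]/(idfun z') -hK /= /g ideal_val_sum.
by apply: eq_bigr => k _; rewrite -mulrA divfK //= mulrC.
Qed.

(** The generators satisfy a_i0 a_j = a_j a_i0, which after multiplication by a
    common denominator [d] are linear relations with coefficients in (I : I).
    A vector c of coefficients that satisfies a_i0 c_j = c_i0 a_j has the form
    c = q a, so that [q] sends all generators, hence [I], into (I : I); and the
    expression of a_i0 given by the equational criterion, divided by a_i0,
    reads 1 = \sum_k y_k q_k. *)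
Lemma flat_dual_basis I n (a : 'I_n -> F) :
  (forall i, I (a i)) -> (exists i, a i != 0) ->
  (forall x, I x -> exists c : 'I_n -> D, x = \sum_i (c i)%:F * a i) ->
  @flat_module (colon_ring I) (ideal_module I) ->
  exists l (y q : 'I_l -> F),
    [/\ forall k, I (y k), forall k x, I x -> colon_set I (q k * x) &
        \sum_k y k * q k = 1].
Proof.
move=> Ia [i0 ai0] genI flatI.
pose a' k := to_ideal (Ia k).
have [d d0 dI] := ideal_denom I.
have /choice[e ae] k : exists e : D, d%:F * a k = e%:F by apply: dI.
(* Row vectors r are sent to e_i0 r - r_i0 e, where e = d a. *)
pose A : 'M[colon_ring I]_n :=
  (to_colon I (e i0))%:M - \matrix_(i, j) ((i == i0)%:R * to_colon I (e j)).
have rel j : \sum_i A i j *: a' i = 0.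
  under eq_bigr => i _ do rewrite !mxE scalerBl.
  rewrite sumrB (bigD1 j) //= eqxx mulr1n big1 ?addr0; last first.
    by move=> i /negPf ->; rewrite mulr0n scale0r.
  rewrite (bigD1 i0) //= eqxx mul1r big1 ?addr0; last first.
    by move=> i /negPf ->; rewrite mul0r scale0r.
  apply/eqP; rewrite subr_eq0; apply/eqP/val_inj => /=.
  by rewrite -!ae mulrAC.
have [l [C [y [CA yE]]]] := flat_equational flatI rel.
pose q k := colon_val (C k i0) / a i0.
have qE k j : q k * a j = colon_val (C k j).
  have /matrixP/(_ k j) := CA.
  rewrite mulmxBr mul_mx_scalar !mxE (bigD1 i0) //= big1 ?addr0; last first.
    by move=> i /negPf ii0; rewrite !mxE ii0 mul0r mulr0.
  rewrite !mxE eqxx mul1r => /eqP; rewrite subr_eq0 => /eqP/(congr1 (@colon_val _ I)).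
  rewrite /= -!ae -mulrA [RHS]mulrCA => /mulfI; rewrite tofrac_eq0 => /(_ d0) e1.
  by apply: (mulfI ai0); rewrite [RHS]e1 /q mulrA [a i0 * _]mulrC divfK.
exists l, (fun k => ideal_val (y k)), q; split=> [k|k x /genI[c ->]|].
- exact/ideal_predE/ideal_valP.
- rewrite mulr_sumr; apply/colon_predE; apply: rpred_sum => i _.
  rewrite mulrCA qE; apply: rpredM; last exact: colon_valP.
  exact/colon_predE/range_sub_colon.
apply: (mulIf ai0); rewrite mul1r mulr_suml -[RHS]/(ideal_val (a' i0)) yE.
rewrite ideal_val_sum; apply: eq_bigr => k _.
by rewrite -mulrA qE /= mulrC.
Qed.

Hypothesis Dic : integrally_closed D.

Lemma finitely_stable_prufer : finitely_stable_domain D -> prufer_domain D.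
Proof.
move=> stD I I0 fgI; have [_ projI] := stD I I0 fgI.
have [n [a [Ia genI _]]] := fg_ideal_generators I0 fgI.
have [q [qI e1]] := projective_dual_basis I0 Ia genI projI.
apply: (dual_basis_invertible I0 (a := a) (b := q)); split=> // k x Ix.
exact/(integrally_closed_colon Dic I0 fgI)/qI.
Qed.

Lemma quasi_stable_prufer : quasi_stable_domain D -> prufer_domain D.
Proof.
move=> qsD I I0 fgI; have [_ flatI] := qsD I I0.
have [n [a [Ia genI a0]]] := fg_ideal_generators I0 fgI.
have [l [y [q [Iy qI e1]]]] := flat_dual_basis Ia a0 genI flatI.
apply: (dual_basis_invertible I0 (a := y) (b := q)); split=> // k x Ix.
exact/(integrally_closed_colon Dic I0 fgI)/qI.
Qed.

End IntegrallyClosed.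

Theorem proposition2p7 (D : idomainType) (hD : integrally_closed D) :
  (quasi_stable_domain D <-> finitely_stable_domain D) /\
  (finitely_stable_domain D <-> prufer_domain D).
Proof.
have qp := quasi_stable_prufer hD; have sp := finitely_stable_prufer hD.
have pq := @prufer_quasi_stable D; have ps := @prufer_finitely_stable D.
by split; split; auto.
Qed.
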